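(* Let $\mathcal{G}$, the weights, and $\epsilon>0$ be as in the context, and let $M$ be the associated $2n\times 2n$ matrix. The deterministic algorithm achieves average consensus if and only if $1$ is a simple eigenvalue of $M$ and all other eigenvalues of $M$ have modulus strictly smaller than one.
   Context: Setting: $\mathcal{G}=(\mathcal{V},\mathcal{E})$ is a digraph with $\mathcal{V}=\{1,\dots,n\}$, $n>1$, and no selfloops. An edge $(j,i)$ means that $j$ sends to $i$. Write $\mathcal{N}_i^+=\{j:(j,i)\in\mathcal{E}\}$ and $\mathcal{N}_i^-=\{h:(i,h)\in\mathcal{E}\}$. Weights: $a_{ij}\in(0,1)$ if $j\in\mathcal{N}_i^+$, $a_{ij}=0$ otherwise, and $\sum_j a_{ij}<1$. Also $b_{ih}\in(0,1)$ if $h\in\mathcal{N}_i^-$, $b_{ih}=0$ otherwise, and $\sum_h b_{ih}<1$. Matrices: $L=D-A$, where $A=[a_{ij}]$ and $D=\mathrm{diag}(\sum_j a_{ij})$. $S=(I-\tilde D)+B$, where $B=[b_{ih}]^T$ and $\tilde D=\mathrm{diag}(\sum_h b_{ih})$. The parameter is $\epsilon>0$ and $M=\begin{bmatrix} I-L & \epsilon I\\ L & S-\epsilon I\end{bmatrix}$. Deterministic algorithm: $(x(k+1),s(k+1))^T=M(x(k),s(k))^T$ with $x(k),s(k)\in\mathbb{R}^n$ and $s(0)=0$. Average consensus: the algorithm achieves it if for every $x(0)$ we have $(x(k),s(k))\to(x_a\mathbf{1},0)$ as $k\to\infty$, where $x_a=\mathbf{1}^Tx(0)/n$. *)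

(* Defs.v *)
From HB Require Import structures.
From mathcomp Require Import all_boot all_order all_algebra.
From mathcomp Require Import all_classical all_reals all_analysis.
From mathcomp Require Import complex.
Set Implicit Arguments. Unset Strict Implicit. Unset Printing Implicit Defensive.
Import Order.TTheory GRing.Theory Num.Theory.
Import numFieldNormedType.Exports.
Local Open Scope ring_scope.
Local Open Scope complex_scope.
Local Open Scope classical_set_scope.
Local Open Scope ring_scope.

Section Consensus.
Variables (R : realType) (n : nat).

(* a : 'M_n with a i j = a_ij ; edge relation E j i means (j,i) in E, j sends to i *)
Definition admissible_graph (E : rel 'I_n) : Prop := forall i, ~~ E i i.

Definition admissible_A (E : rel 'I_n) (a : 'M[R]_n) : Prop :=
  (forall i j, E j i -> 0 < a i j < 1) /\
  (forall i j, ~~ E j i -> a i j = 0) /\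
  (forall i, \sum_j a i j < 1).

Definition admissible_B (E : rel 'I_n) (b : 'M[R]_n) : Prop :=
  (forall i h, E i h -> 0 < b i h < 1) /\
  (forall i h, ~~ E i h -> b i h = 0) /\
  (forall i, \sum_h b i h < 1).

Definition Dmat (a : 'M[R]_n) : 'M[R]_n := diag_mx (\row_i \sum_j a i j).
Definition Lmat (a : 'M[R]_n) : 'M[R]_n := Dmat a - a.
Definition Bmat (b : 'M[R]_n) : 'M[R]_n := b^T.
Definition Dtmat (b : 'M[R]_n) : 'M[R]_n := diag_mx (\row_i \sum_h b i h).
Definition Smat (b : 'M[R]_n) : 'M[R]_n := (1%:M - Dtmat b) + Bmat b.

Definition Mmat (a b : 'M[R]_n) (eps : R) : 'M[R]_(n + n) :=
  block_mx (1%:M - Lmat a) (eps%:M) (Lmat a) (Smat b - eps%:M).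

(* state (x(k), s(k)) stacked as a column vector of size 2n *)
Definition traj (M : 'M[R]_(n + n)) (x0 : 'cV[R]_n) (k : nat) : 'cV[R]_(n + n) :=
  iter k (mulmx M) (col_mx x0 0).

Definition average (x0 : 'cV[R]_n) : R := (\sum_i x0 i 0) / n%:R.

Definition achieves_average_consensus (M : 'M[R]_(n + n)) : Prop :=
  forall x0 : 'cV[R]_n, forall r : 'I_(n + n),
    (fun k => traj M x0 k r 0) @ \oo -->
      (col_mx (const_mx (average x0)) (0 : 'cV[R]_n) : 'cV[R]_(n + n)) r 0.

Definition cplx_mx (M : 'M[R]_(n + n)) : 'M[R[i]]_(n + n) := map_mx (fun x => x%:C) M.

Definition spectral_condition (M : 'M[R]_(n + n)) : Prop :=
  mup 1 (char_poly (cplx_mx M)) = 1%N /\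
  (forall z : R[i], root (char_poly (cplx_mx M)) z -> z != 1 -> `|z| < 1).

End Consensus.

(* Main.v *)
Require Import Defs.
From HB Require Import structures.
From mathcomp Require Import all_boot all_order all_algebra.
From mathcomp Require Import all_classical all_reals all_analysis.
From mathcomp Require Import complex.
From mathcomp Require Import ring lra.
Set Implicit Arguments. Unset Strict Implicit. Unset Printing Implicit Defensive.
Import Order.TTheory GRing.Theory Num.Theory.
Import numFieldNormedType.Exports.
Local Open Scope complex_scope.
Local Open Scope classical_set_scope.
Local Open Scope ring_scope.

(** Write [w = (1, 1)] (row) and [v = (1/n; 0)] (column), so that [w M = w],
    [M v = v] and [w v = 1].  Removing the rank-one part [v w] replaces the
    eigenvalue 1 of [M] by 0, hence the spectral condition says that every
    eigenvalue of [M - v w] has modulus [< 1], and consensus says that the powers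
    of [M - v w] applied to the states [(x; 0)] tend to 0.  The spectral condition
    gives consensus by Cayley-Hamilton.

    Conversely, let [(y, u)] be a left eigenvector of [M - v w] for an eigenvalue
    [z] with [|z| >= 1].  Testing it on [(x; 0)] gives [y = 0], so [u L = 0] and
    [u S = (z + eps) u].  Consensus forces the graph to be strongly connected,
    and a Perron-Frobenius argument then shows that [u] is constant, [1 L = 0] and
    [z = 1 - eps].  It remains to exclude [eps >= 2].  Moving the eigenvalue
    [1 - eps] of [M] to 1 gives a matrix all of whose other eigenvalues are 1 or of
    modulus [< 1], while its determinant is that of [P + (eps/n) J - eps], where
    [P = (1 - L) S] is column stochastic and [J] is the all-ones matrix; this has
    modulus [>= 1] if [eps >= 2].  Then all eigenvalues are 1, which contradicts
    the value of the trace. *)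

(** * Rank-one deflation of a characteristic polynomial *)

(** Both sides come from triangularising the bordered matrix [[c, -v; w, 1]] from either side. The
    factor [c] avoids dividing by [c], which will be a polynomial. *)
Lemma det_scalar_addcr (F : idomainType) N (c : F) (v : 'cV[F]_N)
    (w : 'rV[F]_N) :
  c * \det (c%:M + v *m w) = c ^+ N * (c + (w *m v) 0 0).
Proof.
have e1 : block_mx 1%:M (- v) 0 1%:M *m block_mx (c%:M + v *m w) 0 w 1%:M
    = block_mx c%:M (- v) w 1%:M.
  by rewrite mulmx_block !mul1mx !mul0mx ?mulmx0 !mulmx1 ?add0r ?addr0 mulNmx addrK.
have e2 : block_mx c%:M (- v) w 1%:M *m block_mx 1%:M v 0 c%:M
    = block_mx c%:M 0 w (w *m v + c%:M).
  by rewrite mulmx_block !mulmx1 !mulmx0 !addr0 mul1mx mul_scalar_mx mul_mx_scalar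
    scalerN addrN.
have := congr1 determinant e2; rewrite det_mulmx -e1 det_mulmx !det_ublock.
rewrite !det_lblock !det1 !mulr1 !mul1r !det_scalar expr1 mulrC => ->.
by rewrite det_mx11 !mxE eqxx mulr1n addrC.
Qed.

(** Since [w (X - A) = (X - 1) w], the product of [(X - 1) + v w] and [X - A] is [X - 1] times
    [X - A + v w]. Determinants then give the relation up to a power of [X - 1], which cancels. *)
Lemma char_poly_deflate (F : idomainType) N (A : 'M[F]_N) (v : 'cV[F]_N)
    (w : 'rV[F]_N) :
  w *m A = w -> (w *m v) 0 0 = 1 ->
  ('X - 1%:P) * char_poly (A - v *m w) = 'X * char_poly A.
Proof.
move=> wA wv; set c := 'X - 1%:P.
pose V := map_mx polyC v; pose W := map_mx polyC w.
have WA : W *m map_mx polyC A = W by rewrite -map_mxM wA.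
have e : (c%:M + V *m W) *m char_poly_mx A = c *: char_poly_mx (A - v *m w).
  rewrite /char_poly_mx map_mxB map_mxM -/V -/W opprB mulmxDl mul_scalar_mx.
  rewrite -mulmxA mulmxBr WA mul_mx_scalar -{2}[W]scale1r -scalerBl -/c.
  by rewrite -scalemxAr -scalerDr addrA addrAC.
have /(congr1 ( *%R c)) := congr1 determinant e.
rewrite det_mulmx detZ mulrA det_scalar_addcr -map_mxM mxE wv -mulrA subrK.
rewrite [RHS]mulrCA => e3; apply/esym/(@mulfI _ (c ^+ N)) => //.
by rewrite expf_neq0 // polyXsubC_eq0.
Qed.

(** As ['X] does not vanish at 1, [p] has one more factor [X - 1] than [q]. The only root that [q]
    may gain is 0, covered by [P 0]. *)
Lemma deflate_simple_root (F : fieldType) (p q : {poly F}) (P : F -> bool) :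
  ('X - 1%:P) * q = 'X * p -> q != 0 -> P 0 -> ~~ P 1 ->
  (mup 1 p = 1%N /\ forall z, root p z -> z != 1 -> P z) <->
  (forall z, root q z -> P z).
Proof.
move=> e q0 P0 P1.
have mup1 : mup 1 p = (mup 1 q).+1.
  have <- : mup 1 ('X * p) = mup 1 p by apply: mupMr; rewrite rootX oner_eq0.
  have m1 : mup 1 ('X - 1%:P : {poly F}) = 1%N.
    by have := @mup_XsubCX F 1 1 1; rewrite eqxx expr1.
  by rewrite -e mupM ?polyXsubC_eq0 // m1.
have rootE z : root (('X - 1%:P) * q) z = (z == 1) || root q z.
  by rewrite rootM root_XsubC.
split=> [[m1 hp] z qz|hq].
  have zn1 : z != 1.
    apply: contraTneq qz => ->; apply/negP => q1.
    by move: m1; rewrite mup1 => -[] /eqP;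
      rewrite -leqn0 leqNgt -XsubC_dvd // dvdp_XsubCl q1.
  have : root (('X - 1%:P) * q) z by rewrite rootE qz orbT.
  by rewrite e rootM rootX => /predU1P[->|/hp]; [|apply].
split=> [|z pz zn1].
  by rewrite mup1 mupNroot //; apply: contra P1 => /hq.
have : root (('X - 1%:P) * q) z by rewrite e rootM pz orbT.
by rewrite rootE (negPf zn1) => /hq.
Qed.

(** * Iterates of a matrix *)

Section IterMx.
Variables (F : comNzRingType) (N m : nat) (A : 'M[F]_N).

Lemma iter_mulmx_linear k z (X Y : 'M[F]_(N, m)) :
  iter k (mulmx A) (X - z *: Y) =
  iter k (mulmx A) X - z *: iter k (mulmx A) Y.
Proof.
elim: k => //= k ->.
by rewrite mulmxBr -scalemxAr.
Qed.

Lemma iter_mulmx_eigen k z (w : 'rV[F]_N) (X : 'M[F]_(N, m)) :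
  w *m A = z *: w -> w *m iter k (mulmx A) X = z ^+ k *: (w *m X).
Proof.
move=> wA; elim: k => [|k IH] /=; first by rewrite scale1r.
by rewrite mulmxA wA -scalemxAl IH scalerA exprS.
Qed.

Lemma iter_deflate k (v : 'cV[F]_N) (w : 'rV[F]_N) (X : 'M[F]_(N, m)) :
  w *m A = w -> A *m v = v -> w *m v = 1%:M ->
  iter k (mulmx (A - v *m w)) (X - v *m (w *m X)) =
  iter k (mulmx A) X - v *m (w *m X).
Proof.
move=> wA Av wv; elim: k => //= k ->.
rewrite mulmxBl !mulmxBr !mulmxA Av -!mulmxA [w *m (v *m _)]mulmxA wv mul1mx.
have -> : w *m iter k (mulmx A) X = w *m X.
  by rewrite (@iter_mulmx_eigen _ 1) ?scale1r // expr1n scale1r.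
by rewrite subrr subr0.
Qed.

(** Rewrites a product of linear factors as successive applications of [B - z], the form suited to
    induction over the list of roots. *)
Lemma horner_mx_prod_foldl (N' : nat) (B : 'M[F]_N'.+1) (s : seq F)
    (X : 'M[F]_(N'.+1, m)) :
  horner_mx B (\prod_(z <- s) ('X - z%:P)) *m X =
  foldl (fun Y z => B *m Y - z *: Y) X s.
Proof.
elim: s X => [|z s IH] X /=; first by rewrite big_nil rmorph1 mul1mx.
rewrite -IH big_cons mulrC rmorphM /= -mulmxA rmorphB /= horner_mx_X horner_mx_C.
by rewrite mulmxBl mul_scalar_mx.
Qed.

End IterMx.

Lemma map_iter_mulmx (F G : comNzRingType) (f : {rmorphism F -> G}) N m
    (A : 'M[F]_N) (X : 'M[F]_(N, m)) k :
  map_mx f (iter k (mulmx A) X) = iter k (mulmx (map_mx f A)) (map_mx f X).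
Proof. by elim: k => //= k <-; rewrite map_mxM. Qed.

(** * Geometric decay of matrix powers *)

Section Spectrum.
Variable R : realType.
Implicit Types (z : R[i]).

Lemma normcE_real z : `|z| = (complex.Re `|z|)%:C.
Proof. by rewrite normc_def. Qed.

Lemma Re_norm_ge0 z : 0 <= complex.Re `|z|.
Proof. by rewrite -lecR -normcE_real normr_ge0. Qed.

Lemma norm_real_complex (x : R) : `|x%:C| = `|x|%:C.
Proof. by rewrite normc_def /= expr0n addr0 sqrtr_sqr. Qed.

Lemma uniform_radius (s : seq R[i]) : (forall z, z \in s -> `|z| < 1) ->
  exists2 rho : R, (0 < rho < 1) & forall z, z \in s -> `|z| < rho%:C.
Proof.
elim: s => [|z s IH] hs; first by exists (1 / 2) => //; lra.
have [|rho hrho hlt] := IH; first by move=> y ys; apply: hs; rewrite inE ys orbT.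
have z1 : complex.Re `|z| < 1.
  by rewrite -ltcR -normcE_real; apply: hs; rewrite inE eqxx.
have z0 := Re_norm_ge0 z.
pose t := (1 + complex.Re `|z|) / 2.
have t01 : 0 < t < 1 by rewrite /t; lra.
exists (Num.max rho t) => [|y].
  move/andP: t01 => [t0 t1]; move/andP: hrho => [r0 r1].
  by rewrite lt_max t0 orbT gt_max r1.
rewrite inE => /predU1P[->|/hlt h].
  by rewrite normcE_real ltcR lt_max; apply/orP; right; rewrite /t; lra.
by apply: (lt_le_trans h); rewrite lecR le_max lexx.
Qed.

(** Induction on the list replaces the Jordan form: with [Y = A X - z X], the identity
    [A^(k+1) X = z A^k X + A^k Y] is a linear recurrence whose forcing term already decays like
    [rho ^+ k]. *)
Lemma foldl_geometric_bound N m (A : 'M[R[i]]_N) (s : seq R[i]) (rho : R)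
    (X : 'M[R[i]]_(N, m)) :
  0 < rho -> (forall z, z \in s -> `|z| < rho%:C) ->
  foldl (fun Y z => A *m Y - z *: Y) X s = 0 ->
  exists K : R, forall k i j, `|iter k (mulmx A) X i j| <= (K * rho ^+ k)%:C.
Proof.
move=> r0; elim: s X => [|z s IH] X hs /=.
  move=> ->; exists 0 => k i j.
  suff -> : iter k (mulmx A) (0 : 'M[R[i]]_(N, m)) = 0 by rewrite mxE normr0 mul0r.
  by elim: k => //= k ->; rewrite mulmx0.
move=> /IH [y ys|K hK]; first by apply: hs; rewrite inE ys orbT.
have hz : complex.Re `|z| < rho.
  by rewrite -ltcR -normcE_real; apply: hs; rewrite inE eqxx.
have z0 := Re_norm_ge0 z.
set t := complex.Re `|z| in hz z0.
pose K0 := \sum_i \sum_j complex.Re `|X i j|.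
have K0ge i j : complex.Re `|X i j| <= K0.
  rewrite /K0 (bigD1 i) //= (bigD1 j) //= -addrA lerDl addr_ge0 //.
    by apply: sumr_ge0 => *; exact: Re_norm_ge0.
  by apply: sumr_ge0 => *; apply: sumr_ge0 => *; exact: Re_norm_ge0.
(* [K0] handles [k = 0]; the second bound gives [t K' + K <= rho K'], which closes the induction on
   [k]. *)
pose K' := Num.max K0 (K / (rho - t)).
have hK' : K <= (rho - t) * K'.
  rewrite mulrC -ler_pdivrMr ?subr_gt0 // /K' le_max lexx orbT //.
exists K'; elim=> [|k IHk] i j.
  by rewrite expr0 mulr1 /= normcE_real lecR le_max K0ge.
have e : iter k.+1 (mulmx A) X =
    z *: iter k (mulmx A) X + iter k (mulmx A) (A *m X - z *: X).
  by rewrite iter_mulmx_linear -iterSr addrC subrK.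
rewrite e mxE mxE; apply: (le_trans (ler_normD _ _)).
rewrite normrM normcE_real -/t.
apply: (@le_trans _ _ (t%:C * (K' * rho ^+ k)%:C + (K * rho ^+ k)%:C)).
  by rewrite lerD // ler_wpM2l // lecR.
rewrite -rmorphM -rmorphD lecR exprS.
have := ler_wpM2r (exprn_ge0 k (ltW r0)) hK'.
by rewrite -/t; lra.
Qed.

Lemma iter_mulmx_bound N m (A : 'M[R[i]]_N) (X : 'M[R[i]]_(N, m)) :
  (forall z, root (char_poly A) z -> `|z| < 1) ->
  exists2 rho : R, (0 < rho < 1) &
    exists K : R, forall k i j, `|iter k (mulmx A) X i j| <= (K * rho ^+ k)%:C.
Proof.
case: N A X => [A X _|N A X hA].
  by exists (1 / 2); [lra|exists 0 => k []].
have [s hs] := closed_field_poly_normal (char_poly A).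
rewrite (monicP (char_poly_monic A)) scale1r in hs.
have [|rho hrho hlt] := @uniform_radius s.
  by move=> z zs; apply: hA; rewrite hs root_prod_XsubC.
exists rho => //; apply: (@foldl_geometric_bound _ _ _ s) => //.
  by case/andP: hrho.
by rewrite -horner_mx_prod_foldl -hs Cayley_Hamilton mul0mx.
Qed.

Lemma iter_mulmx_cvg0 N (A : 'M[R]_N) (c : 'cV[R]_N) :
  (forall z, root (char_poly (map_mx (real_complex R) A)) z -> `|z| < 1) ->
  forall r, (fun k => iter k (mulmx A) c r 0) @ \oo --> (0 : R).
Proof.
move=> hA r.
have [rho /andP[r0 r1] [K hK]] :=
  @iter_mulmx_bound _ _ _ (map_mx (real_complex R) c) hA.
apply: norm_cvg0.
apply: (@squeeze_cvgr _ _ _ _ (fun=> 0) (geometric K rho)); last 2 first.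
- exact: cvg_cst.
- by apply: cvg_geometric; rewrite gtr0_norm.
near=> k; rewrite normr_ge0 /=.
by have := hK k r 0; rewrite -map_iter_mulmx mxE norm_real_complex lecR.
Unshelve. all: by end_near. Qed.

(** The modulus of [w A^k c = z^k w c] tends to 0 but never drops below that of [w c]. *)
Lemma eigenrow_orthogonal N (A : 'M[R]_N) (w : 'rV[R[i]]_N) z (c : 'cV[R]_N) :
  w *m map_mx (real_complex R) A = z *: w -> 1 <= `|z| ->
  (forall r, (fun k => iter k (mulmx A) c r 0) @ \oo --> (0 : R)) ->
  w *m map_mx (real_complex R) c = 0.
Proof.
move=> wA z1 hc; apply/matrixP => i j; rewrite !ord1 [RHS]mxE {i j}.
set d := (w *m _) 0 0.
pose g k := \sum_r complex.Re `|w 0 r| * `|iter k (mulmx A) c r 0|.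
have gcvg : g @ \oo --> (0 : R).
  have := @cvg_big R 'I_N +%R 0 xpredT (@add_continuous R) nat \oo
    (index_enum 'I_N) (fun r k => complex.Re `|w 0 r| * `|iter k (mulmx A) c r 0|)
    (fun r => complex.Re `|w 0 r| * `|0 : R|) _.
  rewrite [X in _ --> X]big1 => [|r _]; last by rewrite normr0 mulr0.
  by apply => r _; apply: cvgMr; apply: cvg_norm; exact: hc.
have dg k : complex.Re `|d| <= g k.
  rewrite -lecR -normcE_real; apply: (@le_trans _ _ (`|z| ^+ k * `|d|)).
    by rewrite ler_peMl // exprn_ege1.
  rewrite -normrX -normrM /d.
  have -> : z ^+ k * (w *m map_mx (real_complex R) c) 0 0 =
      (w *m map_mx (real_complex R) (iter k (mulmx A) c)) 0 0.
    by rewrite map_iter_mulmx (iter_mulmx_eigen _ _ wA) [RHS]mxE.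
  rewrite mxE; apply: (le_trans (ler_norm_sum _ _ _)).
  rewrite rmorph_sum; apply: ler_sum => r _.
  by rewrite normrM mxE norm_real_complex rmorphM /= -normcE_real.
have : complex.Re `|d| <= 0.
  rewrite -(cvg_lim _ gcvg) //; apply: limr_ge; first by apply/cvg_ex; exists 0.
  by near=> k; exact: dg.
move=> d0; apply/eqP; rewrite -normr_eq0 normcE_real.
by rewrite (@le_anti _ _ (complex.Re `|d|) 0) // d0 Re_norm_ge0.
Unshelve. all: by end_near. Qed.

End Spectrum.

(* Strong connectivity, phrased as: only the full set is closed under
   out-neighbours. *)
Definition out_connected n (E : rel 'I_n) : Prop :=
  forall T : pred 'I_n, (exists i, T i) ->
    (forall i h, T i -> E i h -> T h) -> forall j, T j.

(** * Perron-Frobenius arguments on a strongly connected graph *)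

Section Harmonic.
Variables (n : nat) (E : rel 'I_n).
Hypothesis conE : out_connected E.

Section LeftKernel.
Variables (C : numDomainType) (a : 'I_n -> 'I_n -> C).
Hypotheses (a_ge0 : forall i j, 0 <= a i j) (a_gt0 : forall i j, E j i -> 0 < a i j).

(* The triangle inequality gives [<=] in each coordinate; the two sides have
   the same sum over [j], so equality holds everywhere. *)
Lemma left_balanced_norm (u : 'I_n -> C) :
  (forall j, u j * (\sum_i a j i) = \sum_i u i * a i j) ->
  forall j, `|u j| * (\sum_i a j i) = \sum_i `|u i| * a i j.
Proof.
move=> hu j; apply/esym/eqP; rewrite -subr_eq0; apply/eqP.
pose f j := \sum_i `|u i| * a i j - `|u j| * (\sum_i a j i).
apply: (@psumr_eq0P _ _ xpredT f) => // [k _|].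
  rewrite /f subr_ge0 -[\sum_i a k i]ger0_norm ?sumr_ge0 // -normrM hu.
  apply: (le_trans (ler_norm_sum _ _ _)); apply: ler_sum => i _.
  by rewrite normrM (ger0_norm (a_ge0 i k)).
rewrite /f sumrB exchange_big /=.
by under [X in X - _]eq_bigr do rewrite -mulr_sumr; rewrite subrr.
Qed.

(** The zero set of [u] is closed under out-neighbours: at a zero, the balance equation for [|u|] is
    a vanishing sum of nonnegative terms, and edges carry positive weight. *)
Lemma left_balanced_eq0 (u : 'I_n -> C) j0 :
  (forall j, u j * (\sum_i a j i) = \sum_i u i * a i j) ->
  u j0 = 0 -> forall j, u j = 0.
Proof.
move=> /left_balanced_norm hu u0 j; apply/eqP.
apply: (@conE (fun j => u j == 0)) => [|i h /eqP ui Eih].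
  by exists j0; rewrite u0.
have /esym := hu i; rewrite ui normr0 mul0r => /psumr_eq0P.
move=> /(_ (fun k _ => mulr_ge0 (normr_ge0 (u k)) (a_ge0 k i)) h isT) /eqP.
by rewrite mulf_eq0 normr_eq0 (gt_eqF (a_gt0 Eih)) orbF.
Qed.

End LeftKernel.

(** At a maximum of [p] the weighted differences give [mu <= 1], at a minimum [mu >= 1]. With
    [mu = 1] the set of maximisers is closed under out-neighbours. *)
Lemma positive_eigen_const (R : realFieldType) (b : 'I_n -> 'I_n -> R)
    (p : 'I_n -> R) (mu : R) :
  (forall i h, 0 <= b i h) -> (forall i h, E i h -> 0 < b i h) ->
  (forall i, 0 < p i) ->
  (forall h, mu * p h = p h + \sum_i b h i * (p i - p h)) ->
  'I_n -> mu = 1 /\ forall i j, p i = p j.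
Proof.
move=> b0 bE p0 hp i0.
pose M := [arg max_(i > i0) p i]%O; pose m := [arg min_(i < i0) p i]%O.
have pM i : p i <= p M by rewrite /M; case: arg_maxP => // k _; apply.
have pm i : p m <= p i by rewrite /m; case: arg_minP => // k _; apply.
have mu1 : mu = 1.
  apply/le_anti/andP; split.
    rewrite -(ler_pM2r (p0 M)) mul1r hp gerDl sumr_le0 // => i _.
    by rewrite mulr_ge0_le0 // subr_le0.
  rewrite -(ler_pM2r (p0 m)) mul1r hp lerDl sumr_ge0 // => i _.
  by rewrite mulr_ge0 // subr_ge0.
split=> //; suff pc : forall i, p i = p M by move=> i j; rewrite !pc.
move=> i.
apply/eqP; apply: (@conE (fun i => p i == p M)) => [|k h /eqP pk Ekh].
  by exists M.
have := hp k; rewrite mu1 mul1r -{1}[p k]addr0 => /addrI/esym/eqP.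
rewrite -oppr_eq0 -sumrN => /eqP /psumr_eq0P h0.
have /(_ _ h isT)/eqP := h0; rewrite oppr_eq0 mulf_eq0 (gt_eqF (bE _ _ Ekh)) /= pk.
rewrite subr_eq0; apply => j _.
by rewrite oppr_ge0 mulr_ge0_le0 // subr_le0.
Qed.

End Harmonic.

(** * The matrices of the algorithm and strong connectivity of the graph *)

Section Algorithm.
Variables (R : realType) (n : nat).
Implicit Types (a b : 'M[R]_n) (eps : R).
Local Notation C := (map_mx (real_complex R)).

Lemma mul_Lmat_col a (x : 'cV[R]_n) i :
  (Lmat a *m x) i 0 = (\sum_j a i j) * x i 0 - \sum_j a i j * x j 0.
Proof. by rewrite /Lmat /Dmat mulmxBl mul_diag_mx !mxE. Qed.

Lemma mul_Smat_col b (s : 'cV[R]_n) i :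
  (Smat b *m s) i 0 = (1 - \sum_h b i h) * s i 0 + \sum_j b j i * s j 0.
Proof.
rewrite /Smat /Dtmat /Bmat mulmxDl mulmxBl mul1mx mul_diag_mx !mxE mulrBl mul1r.
by congr (_ + _); apply: eq_bigr => j _; rewrite mxE.
Qed.

Lemma mul_row_Lmat a (u : 'rV[R[i]]_n) j :
  (u *m C (Lmat a)) 0 j =
  u 0 j * (\sum_i (a j i)%:C) - \sum_i u 0 i * (a i j)%:C.
Proof.
rewrite /Lmat /Dmat map_mxB map_diag_mx mulmxBr mul_mx_diag !mxE rmorph_sum.
by congr (_ - _); apply: eq_bigr => i _; rewrite !mxE.
Qed.

Lemma mul_row_Smat b (u : 'rV[R[i]]_n) h :
  (u *m C (Smat b)) 0 h = u 0 h + \sum_i (b h i)%:C * (u 0 i - u 0 h).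
Proof.
rewrite /Smat /Dtmat /Bmat map_mxD map_mxB map_mx1 map_diag_mx mulmxDr mulmxBr.
rewrite mulmx1 mul_mx_diag !mxE rmorph_sum /= -addrA; congr (_ + _).
under [in RHS]eq_bigr do rewrite mulrBr.
rewrite sumrB addrC mulr_sumr; congr (_ - _); last first.
  by apply: eq_bigr => i _; rewrite mulrC.
by apply: eq_bigr => i _; rewrite !mxE mulrC.
Qed.

Lemma Lmat_const a (c : R) : Lmat a *m const_mx c = 0 :> 'cV_n.
Proof.
apply/colP => i; rewrite mul_Lmat_col !mxE mulr_suml.
by rewrite -sumrB big1 // => j _; rewrite !mxE subrr.
Qed.

Lemma const_Smat b (c : R) : const_mx c *m Smat b = const_mx c :> 'rV_n.
Proof.
apply/rowP => h; apply: (@complexI R).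
have := mul_row_Smat b (C (const_mx c)) h; rewrite -map_mxM [LHS]mxE => ->.
rewrite !mxE big1 ?addr0 // => i _.
by rewrite !mxE subrr mulr0.
Qed.

Lemma mul_Mmat a b eps (x s : 'cV[R]_n) :
  Mmat a b eps *m col_mx x s =
  col_mx (x - Lmat a *m x + eps *: s) (Lmat a *m x + (Smat b *m s - eps *: s)).
Proof. by rewrite /Mmat mul_block_col !mulmxBl mul1mx !mul_scalar_mx. Qed.

Section Support.
Variables (E : rel 'I_n) (a b : 'M[R]_n) (eps : R) (T : pred 'I_n).
Hypotheses (hA : admissible_A E a) (hB : admissible_B E b).
Hypothesis closT : forall i h, T i -> E i h -> T h.

(** Both updates pass information only along edges, so it cannot leave the out-closed set [T]. *)
Lemma traj_support (x0 : 'cV[R]_n) k :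
  (forall i, ~~ T i -> x0 i 0 = 0) ->
  exists x s : 'cV[R]_n, traj (Mmat a b eps) x0 k = col_mx x s /\
    forall i, ~~ T i -> x i 0 = 0 /\ s i 0 = 0.
Proof.
have [_ [a0 _]] := hA; have [_ [b0 _]] := hB.
have NE j i : T j -> ~~ T i -> ~~ E j i.
  by move=> Tj; apply: contra => /closT; apply.
move=> hx; elim: k => [|k [x [s [e h]]]].
  by exists x0, 0; split=> // i Ti; rewrite mxE hx.
exists (x - Lmat a *m x + eps *: s), (Lmat a *m x + (Smat b *m s - eps *: s)).
split=> [|i Ti]; first by rewrite /traj /= -/(traj _ _ _) e mul_Mmat.
have [xi si] := h i Ti.
have Li : (Lmat a *m x) i 0 = 0.
  rewrite mul_Lmat_col xi mulr0 big1 ?subr0 // => j _.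
  have [Tj|/h[-> _]] := boolP (T j); last by rewrite mulr0.
  by rewrite a0 ?mul0r // NE.
have Si : (Smat b *m s) i 0 = 0.
  rewrite mul_Smat_col si mulr0 big1 ?addr0 // => j _.
  have [Tj|/h[_ ->]] := boolP (T j); last by rewrite mulr0.
  by rewrite b0 ?mul0r // NE.
move: (Lmat a *m x) (Smat b *m s) Li Si => p q Li Si.
by split; rewrite !mxE ?xi si Li ?Si; ring.
Qed.

End Support.

(** A unit placed in a proper closed set leaves an outside vertex at 0 forever, while consensus
    would send that vertex to [1/n]. *)
Lemma consensus_out_connected (E : rel 'I_n) a b eps :
  admissible_A E a -> admissible_B E b ->
  achieves_average_consensus (Mmat a b eps) -> out_connected E.
Proof.
move=> hA hB cons T [i0 Ti0] closT j; apply/negPn/negP => Tj.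
pose x0 : 'cV[R]_n := delta_mx i0 0.
have := cons x0 (lshift n j); rewrite col_mxEu mxE.
rewrite (_ : (fun k => _) = (fun=> 0)); last first.
  apply/funext => k; have [|x [s [-> /(_ j Tj) [xj _]]]] :=
    @traj_support E a b eps T hA hB closT x0 k.
    by move=> i Ti; rewrite mxE; case: eqVneq Ti => // ->; rewrite Ti0.
  by rewrite col_mxEu.
move=> h; have : average x0 = 0.
  by rewrite -(cvg_lim _ h) // lim_cst.
have -> : average x0 = n%:R^-1.
  rewrite /average (bigD1 i0) //= big1 ?mxE ?eqxx ?addr0 ?mul1r // => i /negPf ii.
  by rewrite mxE ii.
move/eqP; rewrite invr_eq0 pnatr_eq0 => n0.
by have := leq_ltn_trans (leq0n j) (ltn_ord j); rewrite lt0n n0.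
Qed.

(* [|u|] is again in the left kernel of [L], hence positive and proportional to
   [u]; it is then a positive eigenvector of the column-stochastic [S], whose
   maximal and minimal entries force the eigenvalue 1 and constancy. *)
Lemma left_kernel_eigen_const (E : rel 'I_n) a b (u : 'rV[R[i]]_n) (lam : R[i]) :
  admissible_A E a -> admissible_B E b -> out_connected E ->
  u *m C (Lmat a) = 0 -> u *m C (Smat b) = lam *: u -> u != 0 ->
  lam = 1 /\ exists2 c, u = const_mx c & c != 0.
Proof.
move=> [aE [aN _]] [bE [bN _]] conE uL uS un0.
have a_gt0 i j : E j i -> 0 < a i j by move=> /aE/andP[].
have a_ge0 i j : 0 <= a i j.
  by have [/a_gt0/ltW//|/aN->] := boolP (E j i).
have b_gt0 i j : E i j -> 0 < b i j by move=> /bE/andP[].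
have b_ge0 i j : 0 <= b i j.
  by have [/b_gt0/ltW//|/bN->] := boolP (E i j).
have ca_ge0 i j : 0 <= (a i j)%:C by rewrite lecR.
have ca_gt0 i j : E j i -> 0 < (a i j)%:C by move=> h; rewrite ltcR a_gt0.
have bal j : u 0 j * (\sum_i (a j i)%:C) = \sum_i u 0 i * (a i j)%:C.
  by apply/eqP; rewrite -subr_eq0 -mul_row_Lmat uL mxE.
have [i0 ui0] : exists i0, u 0 i0 != 0.
  by apply/existsP; apply: contraR un0 => /existsPn h; apply/eqP/rowP => i;
    rewrite mxE; apply/eqP/negPn/h.
have un j : u 0 j != 0.
  apply: contraNneq un0 => uj.
  by apply/eqP/rowP => i; rewrite mxE (left_balanced_eq0 conE ca_ge0 ca_gt0 bal uj).
have baln := left_balanced_norm ca_ge0 bal.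
(* [c] is the phase of [u] at [i0]; [u - c |u|] lies in the left kernel of [L] and vanishes at [i0],
   hence everywhere. *)
pose c := u 0 i0 / `|u 0 i0|.
have uc j : u 0 j = c * `|u 0 j|.
  apply/eqP; rewrite -subr_eq0; apply/eqP.
  apply: (@left_balanced_eq0 _ _ conE _ _ ca_ge0 ca_gt0
    (fun j => u 0 j - c * `|u 0 j|) i0) => [k|].
    rewrite mulrBl bal -mulrA baln mulr_sumr -sumrB.
    by apply: eq_bigr => i _; rewrite mulrBl mulrA.
  by rewrite /c divfK ?subrr // normr_eq0.
have c0 : c != 0 by apply: contraNneq ui0 => c0; rewrite uc c0 mul0r.
pose p j := complex.Re `|u 0 j|.
have pE j : `|u 0 j| = (p j)%:C by rewrite /p -normcE_real.
have p0 j : 0 < p j by rewrite -ltcR -pE normr_gt0.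
have eig h : lam * (p h)%:C = (p h + \sum_i b h i * (p i - p h))%:C.
  have := congr1 (fun M : 'rV_n => M 0 h) uS; rewrite mul_row_Smat mxE.
  rewrite [u 0 h]uc pE mulrCA => /esym e; apply: (mulfI c0); rewrite e.
  rewrite rmorphD rmorph_sum mulrDr mulr_sumr; congr (_ + _).
  apply: eq_bigr => i _; rewrite [u 0 i]uc pE rmorphM rmorphB /=; ring.
(* Solving the eigenvalue equation at [i0] shows that [lam] is real. *)
pose mu := (p i0 + \sum_i b i0 i * (p i - p i0)) / p i0.
have lamE : lam = mu%:C.
  have pi0 : (p i0)%:C != 0 by rewrite -pE normr_eq0.
  by apply: (mulIf pi0); rewrite eig -rmorphM /mu divfK ?gt_eqF.
have [|mu1 pc] := @positive_eigen_const _ _ conE _ (fun i j => b i j) p mu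
    b_ge0 b_gt0 p0 _ i0.
  by move=> h; apply: (@complexI R); rewrite -eig lamE rmorphM.
split; first by rewrite lamE mu1.
exists (u 0 i0) => //; apply/rowP => j.
by rewrite mxE [LHS]uc [RHS]uc !pE (pc j i0).
Qed.

End Algorithm.

(** * Eigenvalues, determinant, trace and stochastic matrices *)

Section EigenvalueProduct.
Variables (R : realType).

Lemma char_poly_roots N (A : 'M[R[i]]_N) : exists s : seq R[i],
  [/\ forall z, (z \in s) = root (char_poly A) z, \det A = \prod_(z <- s) z,
      \tr A = \sum_(z <- s) z & size s = N].
Proof.
have [s hs] := closed_field_poly_normal (char_poly A).
rewrite (monicP (char_poly_monic A)) scale1r in hs.
have sN : size s = N.
  by apply: succn_inj; rewrite -(size_char_poly A) hs size_prod_XsubC.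
exists s; split=> //.
- by move=> z; rewrite hs root_prod_XsubC.
- have := char_poly_det A; rewrite hs coef0_prod_XsubC sN.
  by move/mulfI => ->//; rewrite signr_eq0.
have [N0|N0] := posnP N.
  rewrite (size0nil (etrans sN N0)) big_nil /mxtrace.
  by case: N A {hs sN} N0 => // A _; rewrite big_ord0.
have := char_poly_trace A N0; rewrite hs -{1}sN coefPn_prod_XsubC ?sN -?lt0n //.
by move/oppr_inj.
Qed.

Lemma det_norm_ge1 N (A : 'M[R[i]]_N) :
  (forall z, root (char_poly A) z -> 1 <= `|z|) -> 1 <= `|\det A|.
Proof.
have [s [hs -> _ _]] := char_poly_roots A => h.
rewrite normr_prod big_seq; elim/big_ind: _ => // [x y|z]; first exact: mulr_ege1.
by rewrite hs => /h.
Qed.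

(** No eigenvalue exceeds modulus 1, so a product of modulus at least 1 forces every factor to
    modulus at least 1, hence to be 1. *)
Lemma trace_of_unit_spectrum N (A : 'M[R[i]]_N) :
  (forall z, root (char_poly A) z -> 1 <= `|z| -> z = 1) -> 1 <= `|\det A| ->
  \tr A = N%:R.
Proof.
have [s [hs -> -> sN]] := char_poly_roots A => h; rewrite normr_prod => h1.
have hle z : z \in s -> `|z| <= 1.
  rewrite hs => zs; have [|/ltW//] := real_leP (real1 _) (normr_real z).
  by move/(h z zs) => ->; rewrite normr1.
have s1 z : z \in s -> z = 1.
  move=> zs; apply: h; first by rewrite -hs.
  apply: (le_trans h1); rewrite (big_rem z) //= ler_piMr // big_seq.
  by apply: prodr_ile1 => y /mem_rem /hle; rewrite normr_ge0.
rewrite (eq_big_seq (fun=> 1)) //.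
by rewrite big_const_seq count_predT sN iter_addr_0.
Qed.

(** Right multiplication by [G] does not increase the sum of the moduli of a row's entries. *)
Lemma stochastic_eigen_le1 n (G : 'M[R]_n) (r : 'rV[R[i]]_n) lam :
  (forall i j, 0 <= G i j) -> G *m const_mx 1 = const_mx 1 :> 'cV_n ->
  r *m map_mx (real_complex R) G = lam *: r -> r != 0 -> `|lam| <= 1.
Proof.
move=> G0 G1 rG rn0.
have sumG i : \sum_j G i j = 1.
  have := congr1 (fun M : 'cV_n => M i 0) G1; rewrite !mxE => e; rewrite -[RHS]e.
  by apply: eq_bigr => j _; rewrite !mxE mulr1.
have r0 : 0 < \sum_j `|r 0 j|.
  rewrite lt_def sumr_ge0 // andbT; apply: contraNneq rn0 => /psumr_eq0P r0.
  by apply/eqP/rowP => j; rewrite mxE; apply/eqP; rewrite -normr_eq0 r0.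
rewrite -(ler_pM2r r0) mul1r mulr_sumr.
apply: (@le_trans _ _ (\sum_j \sum_i `|r 0 i| * (G i j)%:C)).
  apply: ler_sum => j _; have := congr1 (fun M : 'rV_n => M 0 j) rG.
  rewrite !mxE -normrM => <-; apply: (le_trans (ler_norm_sum _ _ _)).
  apply: ler_sum => i _; rewrite normrM mxE [`|_%:C|]ger0_norm //.
  by rewrite lecR.
rewrite exchange_big /=; apply: ler_sum => i _.
by rewrite -mulr_sumr -rmorph_sum sumG mulr1.
Qed.

End EigenvalueProduct.

Section Consensus.
Variables (R : realType) (n : nat).
Implicit Types (a b : 'M[R]_n) (eps : R).
Local Notation C := (map_mx (real_complex R)).

(** * The balanced case: excluding [eps >= 2] *)

Section Balanced.
Variables (E : rel 'I_n) (a b : 'M[R]_n) (eps : R).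
Hypotheses (n1 : (1 < n)%N) (hA : admissible_A E a) (hB : admissible_B E b).
Hypotheses (conE : out_connected E) (eps0 : 0 < eps).
Hypothesis eL : const_mx 1 *m Lmat a = 0 :> 'rV_n.

Let J : 'M[R]_n := const_mx (eps / n%:R).

(* In the balanced case [M] has the left eigenvector [(0, 1)] for the eigenvalue
   [1 - eps]; this rank-one modification moves that eigenvalue to 1 without
   changing the trajectories that start with [s = 0]. *)
Let M3 : 'M[R]_(n + n) :=
  block_mx (1%:M - Lmat a) eps%:M (Lmat a) (Smat b - eps%:M + J).

Let nR0 : n%:R != 0 :> R. Proof. by rewrite pnatr_eq0 -lt0n ltnW. Qed.

Let a_ge0 i j : 0 <= a i j.
Proof.
have [aE [aN _]] := hA.
by have [/aE/andP[/ltW//]|/aN->] := boolP (E j i).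
Qed.

Let b_ge0 i j : 0 <= b i j.
Proof.
have [bE [bN _]] := hB.
by have [/bE/andP[/ltW//]|/bN->] := boolP (E i j).
Qed.

(** [1 L = 0] and [1 S = 1] keep the entries of [s] summing to 0, and [J] annihilates such [s]. *)
Lemma traj_modified (x : 'cV[R]_n) k :
  iter k (mulmx M3) (col_mx x 0) = traj (Mmat a b eps) x k.
Proof.
rewrite /traj; suff [x' [s' [-> -> _]]] : exists x' s' : 'cV[R]_n,
    [/\ iter k (mulmx M3) (col_mx x 0) = col_mx x' s',
        iter k (mulmx (Mmat a b eps)) (col_mx x 0) = col_mx x' s' &
        const_mx 1 *m s' = 0 :> 'rV_1] by [].
elim: k => [|k [x' [s' [e1 e2 e3]]]]; first by exists x, 0; rewrite mulmx0.
exists (x' - Lmat a *m x' + eps *: s').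
exists (Lmat a *m x' + (Smat b *m s' - eps *: s')).
have Js : J *m s' = 0.
  apply/colP => i; have := congr1 (fun M : 'M[R]_1 => M 0 0) e3; rewrite !mxE => e4.
  transitivity ((eps / n%:R) * \sum_j (const_mx 1 : 'rV[R]_n) 0 j * s' j 0).
    by rewrite mulr_sumr; apply: eq_bigr => j _; rewrite !mxE mul1r.
  by rewrite e4 mulr0.
rewrite 2!iterS e1 e2 mul_Mmat; split; [|by []|].
  by rewrite -mul_Mmat /Mmat /M3 !mul_block_col [(_ + J) *m _]mulmxDl Js addr0.
by rewrite mulmxDr mulmxA eL mul0mx add0r mulmxBr mulmxA const_Smat -scalemxAr
  e3 scaler0 subr0.
Qed.

(** Subtracting the constant row with value [u 0 i0] leaves a left kernel element that vanishes at
    [i0], hence is zero. *)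
Lemma left_kernel_const (u : 'rV[R[i]]_n) :
  u *m C (Lmat a) = 0 -> exists c, u = const_mx c.
Proof.
move=> uL; pose i0 : 'I_n := Ordinal (ltnW n1); exists (u 0 i0).
have ca_ge0 i j : 0 <= (a i j)%:C by rewrite lecR.
have ca_gt0 i j : E j i -> 0 < (a i j)%:C.
  by have [aE _] := hA; move=> /aE/andP[h _]; rewrite ltcR.
have bal (w : 'rV[R[i]]_n) : w *m C (Lmat a) = 0 ->
    forall j, w 0 j * (\sum_i (a j i)%:C) = \sum_i w 0 i * (a i j)%:C.
  by move=> wL j; apply/eqP; rewrite -subr_eq0 -mul_row_Lmat wL mxE.
have d0 : (u - u 0 i0 *: C (const_mx 1)) *m C (Lmat a) = 0.
  by rewrite mulmxBl uL -scalemxAl -map_mxM eL map_mx0 scaler0 subr0.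
apply/rowP => j; apply/eqP; rewrite -subr_eq0 mxE.
have := left_balanced_eq0 conE ca_ge0 ca_gt0 (bal _ d0) (j0 := i0).
rewrite !mxE mulr1 subrr => /(_ erefl j); rewrite !mxE mulr1.
by move=> ->.
Qed.

(** Consensus from mean-zero initial states makes the first half [y] of a left eigenvector constant,
    so [y L = 0]. If [z != 1], then [y = 0] and [u] is constant, but on such [u] the term [J] makes
    the eigenvalue 1. *)
Lemma modified_eigenvalue z :
  achieves_average_consensus (Mmat a b eps) ->
  root (char_poly (C M3)) z -> 1 <= `|z| -> z = 1.
Proof.
move=> cons; rewrite -eigenvalue_root_char => /eigenvalueP[w wM wn0] z1.
have yx (x : 'cV[R]_n) : \sum_i x i 0 = 0 ->
    w *m C (col_mx x 0) = 0.
  move=> x0; apply: (eigenrow_orthogonal wM z1) => r.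
  have := cons x r; rewrite /average x0 mul0r.
  have -> : (col_mx (const_mx 0) 0 : 'cV[R]_(n + n)) r 0 = 0.
    by rewrite mxE; case: (fintype.split r) => i; rewrite mxE.
  by under eq_fun do rewrite -traj_modified.
rewrite -[w]hsubmxK in wM wn0 yx.
set y := lsubmx w in wM wn0 yx; set u := rsubmx w in wM wn0 yx.
pose i0 : 'I_n := Ordinal (ltnW n1).
have [c yc] : exists c, y = const_mx c.
  exists (y 0 i0); apply/rowP => j; rewrite mxE.
  have := yx (delta_mx j 0 - delta_mx i0 0); rewrite map_col_mx mul_row_col.
  rewrite map_mx0 mulmx0 addr0 map_mxB mulmxBr !map_delta_mx -!colE => h.
  apply/eqP; rewrite -subr_eq0; apply/eqP.
  have /h/(congr1 (fun M : 'M[R[i]]_1 => M 0 0)) :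
      \sum_i (delta_mx j 0 - delta_mx i0 0 : 'cV[R]_n) i 0 = 0.
    have sd k : \sum_i (delta_mx k 0 : 'cV[R]_n) i 0 = 1.
      rewrite (bigD1 k) //= big1 ?mxE ?eqxx ?addr0 // => i /negPf ik.
      by rewrite mxE ik.
    by under eq_bigr do rewrite mxE [X in _ + X]mxE; rewrite sumrB !sd subrr.
  by rewrite !mxE.
move: wM; rewrite /M3 map_block_mx mul_row_block scale_row_mx => /eq_row_mx[].
have yL : y *m C (Lmat a) = 0.
  have -> : y = c *: C (const_mx 1) by apply/rowP => j; rewrite yc !mxE mulr1.
  by rewrite -scalemxAl -map_mxM eL map_mx0 scaler0.
rewrite map_mxB map_mx1 mulmxBr mulmx1 yL subr0 => e1 e2.
apply/eqP/negPn/negP => zn1.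
have uLE : u *m C (Lmat a) = (z - 1) *: y.
  by rewrite scalerBl scale1r -e1 addrC addKr.
(* Multiplying [u L = (z - 1) y] by the ones column kills the left side, as [L 1 = 0]. *)
have c0 : c = 0.
  have : u *m C (Lmat a) *m C (const_mx 1 : 'cV_n) = 0.
    by rewrite -mulmxA -map_mxM Lmat_const map_mx0 mulmx0.
  rewrite uLE -scalemxAl => /(congr1 (fun M : 'M[R[i]]_1 => M 0 0)); rewrite !mxE.
  under eq_bigr do rewrite yc !mxE mulr1.
  rewrite sumr_const card_ord => /eqP; rewrite mulf_eq0 subr_eq0 (negPf zn1) /=.
  by rewrite mulrn_eq0 -[n == 0%N]negbK -lt0n ltnW //= => /eqP.
have y0 : y = 0 by rewrite yc c0; apply/rowP => j; rewrite !mxE.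
have [d ud] : exists d, u = const_mx d.
  by apply: left_kernel_const; rewrite uLE y0 scaler0.
move: e2; rewrite y0 mul0mx add0r map_mxD map_mxB map_scalar_mx mulmxDr mulmxBr.
have uE : u = d *: C (const_mx 1) by apply/rowP => j; rewrite ud !mxE mulr1.
have uS : u *m C (Smat b) = u.
  by rewrite uE -scalemxAl -map_mxM const_Smat.
have uJ : u *m C J = eps%:C *: u.
  rewrite ud; apply/rowP => j; rewrite !mxE.
  under eq_bigr do rewrite !mxE.
  rewrite sumr_const card_ord -mulrnAr -rmorphMn /= -mulr_natr divfK //.
  by rewrite mulrC.
rewrite uS uJ mul_mx_scalar subrK => /esym/eqP.
rewrite -subr_eq0 -{2}[u]scale1r -scalerBl scaler_eq0 subr_eq0 (negPf zn1) /=.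
by move=> /eqP u0; rewrite y0 u0 row_mx0 eqxx in wn0.
Qed.

Let Q : 'M[R]_n := (1%:M - Lmat a) *m Smat b + J - eps%:M.

(** Adding the second block row to the first turns the top left block into the identity; [Q] is the
    Schur complement of that block, simplified by [L J = 0]. *)
Lemma det_modified : \det M3 = \det Q.
Proof.
have LJ : Lmat a *m J = 0.
  apply/matrixP => i j.
  have := congr1 (fun M : 'cV_n => M i 0) (Lmat_const a (eps / n%:R)).
  by rewrite !mxE => e; rewrite -[RHS]e; apply: eq_bigr => k _; rewrite !mxE.
have e0 : block_mx 1%:M 1%:M 0 1%:M *m M3 =
    block_mx 1%:M (Smat b + J) (Lmat a) (Smat b - eps%:M + J).
  rewrite /M3 mulmx_block !mul1mx !mul0mx !add0r subrK; congr block_mx.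
  by rewrite addrA addrCA subrr addr0.
have e : block_mx 1%:M 0 (- Lmat a) 1%:M *m (block_mx 1%:M 1%:M 0 1%:M *m M3) =
    block_mx 1%:M (Smat b + J) 0 Q.
  rewrite e0 mulmx_block !mul1mx !mul0mx !addr0 mulmx1 addNr; congr block_mx.
  rewrite mulmxDr !mulNmx LJ oppr0 addr0 /Q [(1%:M - _) *m _]mulmxBl mul1mx.
  move: (Lmat a *m Smat b) => X; move: (Smat b) eps%:M J => Y Z T.
  by rewrite addrC addrAC [Y - Z - X]addrAC [LHS]addrAC.
have := congr1 determinant e.
by rewrite !det_mulmx det_lblock !det_ublock !det1 !mul1r.
Qed.

(** Since [1 Q = 1], an eigenvector of [Q] with nonzero sum has [mu = 1]. One with zero sum is
    killed by [J], so [mu + eps] is an eigenvalue of the stochastic part and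
    [|mu| >= eps - 1 >= 1]. *)
Lemma det_modified_ge1 : 2 <= eps -> 1 <= `|\det (C M3)|.
Proof.
(* Transposing turns column eigenvectors of [Q] into rows and its column-stochastic part into the
   row-stochastic [G]. *)
move=> eps2; rewrite det_map_mx det_modified -det_tr -det_map_mx.
apply: det_norm_ge1 => mu; rewrite -eigenvalue_root_char => /eigenvalueP[r rQ rn0].
have eQ : const_mx 1 *m Q = const_mx 1 :> 'rV_n.
  rewrite /Q mulmxBr mulmxDr mulmxA mulmxBr mulmx1 eL subr0 const_Smat.
  rewrite mul_mx_scalar (_ : const_mx 1 *m J = eps *: const_mx 1) ?addrK //.
  apply/rowP => j; rewrite !mxE; under eq_bigr do rewrite !mxE mul1r.
  by rewrite sumr_const card_ord -[(eps / _) *+ n]mulr_natr divfK // mulr1.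
have rs : mu *: (r *m C (const_mx 1 : 'cV_n)) = r *m C (const_mx 1 : 'cV_n).
  rewrite scalemxAl -rQ -mulmxA -map_mxM; congr (_ *m C _).
  by rewrite -[RHS]trmx_const -eQ trmx_mul trmx_const.
have [r1|r1] := eqVneq (r *m C (const_mx 1 : 'cV_n)) 0; last first.
  move/eqP: rs; rewrite -subr_eq0 -{2}[r *m _]scale1r -scalerBl scaler_eq0.
  by rewrite (negPf r1) orbF subr_eq0 => /eqP ->; rewrite normr1.
pose G := ((1%:M - Lmat a) *m Smat b)^T.
have G0 i j : 0 <= G i j.
  rewrite !mxE sumr_ge0 // => k _; rewrite !mxE.
  have [_ [_ /(_ j)/ltW da]] := hA; have [_ [_ /(_ i)/ltW db]] := hB.
  apply: mulr_ge0.
    rewrite opprB addrCA addr_ge0 //; case: eqP => _ /=; last by rewrite subrr.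
    by rewrite subr_ge0.
  rewrite addr_ge0 //; case: eqP => [->|_]; last by rewrite subrr.
  by rewrite subr_ge0.
have G1 : G *m const_mx 1 = const_mx 1 :> 'cV_n.
  rewrite -[const_mx 1]trmx_const -trmx_mul mulmxA mulmxBr mulmx1 eL subr0.
  by rewrite const_Smat.
have rG : r *m C G = (mu + eps%:C) *: r.
  have rJ : r *m C J^T = 0.
    apply/rowP => j; rewrite !mxE.
    have := congr1 (fun M : 'M[R[i]]_1 => M 0 0) r1; rewrite !mxE => e4.
    transitivity ((\sum_k r 0 k * C (const_mx 1 : 'cV_n) k 0) * (eps / n%:R)%:C).
      by rewrite mulr_suml; apply: eq_bigr => k _; rewrite !mxE mulr1.
    by rewrite e4 mul0r.
  move: rQ; rewrite /Q linearB linearD /= -/G tr_scalar_mx map_mxB map_mxD.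
  rewrite map_scalar_mx mulmxBr mulmxDr rJ addr0 mul_mx_scalar scalerDl => <-.
  by rewrite subrK.
have := stochastic_eigen_le1 G0 G1 rG rn0 => h.
have : `|eps%:C| <= `|mu + eps%:C| + `|mu|.
  by rewrite -[X in `|X| <= _](addKr mu) addrC; apply: (le_trans (ler_normB _ _)).
move=> h2; have := le_trans h2 (lerD h (lexx _)).
rewrite norm_real_complex gtr0_norm // -lerBlDl; apply: le_trans.
by rewrite -[1]/(1%:C) -rmorphB lecR; lra.
Qed.

(** The diagonal entries of [1 - L] and [S] are at most 1, which bounds the trace by
    [2 n - (n - 1) eps], and [n > 1]. *)
Lemma trace_modified : \tr M3 < (n + n)%:R.
Proof.
have trD (d : 'I_n -> R) (c : R) : (forall i, d i <= c) -> \sum_i d i <= n%:R * c.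
  move=> h; have -> : n%:R * c = \sum_(i < n) c.
    by rewrite sumr_const card_ord mulr_natl.
  by apply: ler_sum => i _; exact: h.
have sg (c : 'M[R]_n) i : (forall i j, 0 <= c i j) -> c i i <= \sum_j c i j.
  by move=> c0; rewrite (bigD1 i) //= lerDl sumr_ge0.
have t1 : \tr (1%:M - Lmat a) <= n%:R * 1.
  apply: trD => i; rewrite !mxE eqxx mulr1n gerBl subr_ge0.
  exact: sg.
have t2 : \tr (Smat b - eps%:M + J) <= n%:R * (1 - eps + eps / n%:R).
  apply: trD => i; rewrite !mxE eqxx !mulr1n.
  by have := sg b i b_ge0; lra.
have t3 : n%:R * (1 - eps + eps / n%:R) = n%:R - n%:R * eps + eps.
  by field.
have n2 : 2 <= n%:R :> R by rewrite (ler_nat R 2).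
rewrite mxtrace_block natrD.
have ne : 2 * eps <= n%:R * eps by rewrite ler_pM2r.
rewrite t3 in t2; rewrite mulr1 in t1; apply: le_lt_trans (lerD t1 t2) _.
rewrite ltrD2l -addrA gtrDl addrC subr_lt0; apply: lt_le_trans ne.
by rewrite ltr_pMl // (ltr_nat R 1).
Qed.

Lemma balanced_eps_lt2 : achieves_average_consensus (Mmat a b eps) -> eps < 2.
Proof.
move=> cons; rewrite ltNge; apply/negP => eps2.
have h1 z : root (char_poly (C M3)) z -> 1 <= `|z| -> z = 1.
  exact: modified_eigenvalue.
have := trace_of_unit_spectrum h1 (det_modified_ge1 eps2).
rewrite trace_map_mx -(rmorph_nat (real_complex R)) => /(@complexI R) e.
by have := trace_modified; rewrite e ltxx.
Qed.

End Balanced.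

(** * Deflation of [M] and the equivalence *)

Let w1 : 'rV[R]_(n + n) := row_mx (const_mx 1) (const_mx 1).
Let v1 : 'cV[R]_(n + n) := col_mx (const_mx n%:R^-1) 0.

Lemma ones_Mmat a b eps : w1 *m Mmat a b eps = w1.
Proof.
rewrite /w1 /Mmat mul_row_block -mulmxDr subrK mulmx1.
by rewrite -mulmxDr addrC subrK const_Smat.
Qed.

Lemma Mmat_mean a b eps : Mmat a b eps *m v1 = v1.
Proof.
by rewrite /v1 mul_Mmat Lmat_const subr0 scaler0 addr0 mulmx0 subr0 addr0.
Qed.

Lemma mean_projection (x : 'cV[R]_n) :
  v1 *m (w1 *m col_mx x 0) = col_mx (const_mx (average x)) 0.
Proof.
rewrite /w1 /v1 mul_row_col mulmx0 addr0 mul_col_mx mul0mx; congr col_mx.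
apply/colP => i; rewrite !mxE big_ord1 !mxE mulrC; congr (_ / _).
by apply: eq_bigr => j _; rewrite mxE mul1r.
Qed.

Lemma ones_mean : (0 < n)%N -> w1 *m v1 = 1%:M.
Proof.
move=> n0; rewrite /w1 /v1 mul_row_col mulmx0 addr0; apply/matrixP => i j.
rewrite !ord1 !mxE; under eq_bigr do rewrite !mxE mul1r.
by rewrite sumr_const card_ord -[_ *+ n]mulr_natr mulVf // pnatr_eq0 -lt0n.
Qed.

Lemma spectral_condition_deflate a b eps : (0 < n)%N ->
  spectral_condition (Mmat a b eps) <->
  (forall z, root (char_poly (C (Mmat a b eps - v1 *m w1))) z -> `|z| < 1).
Proof.
move=> n0; rewrite /spectral_condition /cplx_mx.
rewrite -[map_mx _ (Mmat a b eps)]/(C (Mmat a b eps)).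
have wC : C w1 *m C (Mmat a b eps) = C w1 by rewrite -map_mxM ones_Mmat.
have wvC : (C w1 *m C v1) 0 0 = 1.
  by rewrite -map_mxM ones_mean // !mxE eqxx.
have := char_poly_deflate wC wvC; rewrite -map_mxM -map_mxB.
move=> e; apply: (deflate_simple_root (P := fun z => `|z| < 1) e).
- exact/monic_neq0/char_poly_monic.
- by rewrite normr0.
- by rewrite normr1 ltxx.
Qed.

(** The deflated iterates are exactly the errors of the trajectory, because [v1 w1] maps the initial
    state to the consensus limit. *)
Lemma deflate_consensus a b eps : (0 < n)%N ->
  achieves_average_consensus (Mmat a b eps) <->
  (forall (x : 'cV[R]_n) r,
    (fun k => iter k (mulmx (Mmat a b eps - v1 *m w1))
       (col_mx x 0 - v1 *m (w1 *m col_mx x 0)) r 0) @ \oo --> (0 : R)).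
Proof.
move=> n0.
have it x k r : iter k (mulmx (Mmat a b eps - v1 *m w1))
    (col_mx x 0 - v1 *m (w1 *m col_mx x 0)) r 0 = traj (Mmat a b eps) x k r 0
      - (col_mx (const_mx (average x)) 0 : 'cV[R]_(n + n)) r 0.
  rewrite (iter_deflate k (col_mx x 0) (ones_Mmat a b eps) (Mmat_mean a b eps)
    (ones_mean n0)) mean_projection.
  by rewrite [LHS]mxE [X in _ + X]mxE.
split=> h x r; set l := (col_mx (const_mx (average x)) 0 : 'cV[R]_(n + n)) r 0.
  rewrite (_ : (fun k => _) = (fun k => traj (Mmat a b eps) x k r 0 - l)).
    by have := cvgB (h x r) (cvg_cst l); rewrite subrr; exact.
  by apply/funext => k; rewrite it.
rewrite (_ : (fun k => _) = (fun k => iter k (mulmx (Mmat a b eps - v1 *m w1))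
    (col_mx x 0 - v1 *m (w1 *m col_mx x 0)) r 0 + l)).
  by have := cvgD (h x r) (cvg_cst l); rewrite add0r; exact.
by apply/funext => k; rewrite it subrK.
Qed.

Lemma consensus_spectral (E : rel 'I_n) a b eps :
  (1 < n)%N -> admissible_A E a -> admissible_B E b -> 0 < eps ->
  achieves_average_consensus (Mmat a b eps) ->
  forall z, root (char_poly (C (Mmat a b eps - v1 *m w1))) z -> `|z| < 1.
Proof.
move=> n1 hA hB eps0 cons z.
have n0 : (0 < n)%N := ltnW n1.
rewrite -eigenvalue_root_char => /eigenvalueP[w wM wn0].
have [z1|//] := real_leP (real1 _) (normr_real z).
have zn0 : z != 0 by apply: contraTneq z1 => ->; rewrite normr0 ler10.
(* The deflated matrix kills [v1] and [z] is nonzero, so [w] annihilates [v1]; hence [w] is a left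
   eigenvector of [M] itself for the same [z]. *)
have wv : w *m C v1 = 0.
  have Mv : (Mmat a b eps - v1 *m w1) *m v1 = 0.
    by rewrite mulmxBl Mmat_mean -mulmxA (ones_mean n0) mulmx1 subrr.
  apply/eqP; have /eqP := congr1 (mulmx^~ (C v1)) wM.
  by rewrite -mulmxA -map_mxM Mv map_mx0 mulmx0 -scalemxAl eq_sym
    scaler_eq0 (negPf zn0).
have wx (x : 'cV[R]_n) : w *m C (col_mx x 0) = 0.
  have /deflate_consensus-/(_ n0 x) h := cons.
  have := eigenrow_orthogonal wM z1 h.
  by rewrite map_mxB mulmxBr map_mxM mulmxA wv mul0mx subr0.
have {wM} : w *m C (Mmat a b eps) = z *: w.
  by rewrite -wM map_mxB mulmxBr map_mxM mulmxA wv mul0mx subr0.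
rewrite -[w]hsubmxK in wn0 wx *.
set y := lsubmx w in wn0 wx *; set u := rsubmx w in wn0 wx *.
have y0 : y = 0.
  apply/rowP => j; have := wx (delta_mx j 0); rewrite map_col_mx mul_row_col.
  rewrite map_mx0 mulmx0 addr0 map_delta_mx -colE.
  by move=> /(congr1 (fun M : 'M[R[i]]_1 => M 0 0)); rewrite !mxE.
have un0 : u != 0 by move: wn0; rewrite row_mx_eq0 y0 eqxx.
rewrite y0 /Mmat map_block_mx mul_row_block !mul0mx !add0r scale_row_mx scaler0.
move=> /eq_row_mx[uL uS].
have {}uS : u *m C (Smat b) = (z + eps%:C) *: u.
  by rewrite scalerDl -uS map_mxB map_scalar_mx mulmxBr mul_mx_scalar subrK.
have conE := consensus_out_connected hA hB cons.
have [zeps [c uc c0]] := left_kernel_eigen_const hA hB conE uL uS un0.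
(* Dividing [u L = 0] by the nonzero constant value of [u] gives the balance hypothesis. *)
have eL : const_mx 1 *m Lmat a = 0 :> 'rV_n.
  apply/rowP => j; apply: (@complexI R); apply: (mulfI c0).
  have := congr1 (fun M : 'rV_n => M 0 j) uL.
  have -> : u = c *: C (const_mx 1) by apply/rowP => i; rewrite uc !mxE mulr1.
  by rewrite -scalemxAl -map_mxM [LHS]mxE [X in _ * X]mxE => ->; rewrite !mxE mulr0.
have eps2 := balanced_eps_lt2 n1 hA hB conE eps0 eL cons.
have zE : z = (1 - eps)%:C by rewrite rmorphB rmorph1 -zeps addrK.
(* From [0 < eps < 2], contradicting [1 <= |z|]. *)
have : `|1 - eps| < 1 by rewrite ltr_norml; apply/andP; split; lra.
move: z1; rewrite zE norm_real_complex -(rmorph1 (real_complex R)) lecR leNgt.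
by move=> /negPf->.
Qed.

End Consensus.

Theorem proposition2 (R : realType) (n : nat) (E : rel 'I_n)
    (a b : 'M[R]_n) (eps : R) :
  (1 < n)%N ->
  admissible_graph E ->
  admissible_A E a ->
  admissible_B E b ->
  0 < eps ->
  achieves_average_consensus (Mmat a b eps) <-> spectral_condition (Mmat a b eps).
Proof.
move=> n1 _ hA hB eps0; have n0 := ltnW n1.
apply: (iff_trans _ (iff_sym (spectral_condition_deflate a b eps n0))).
split=> [cons|h]; first exact: consensus_spectral hA hB eps0 cons.
by apply/deflate_consensus => // x r; exact: iter_mulmx_cvg0.
Qed.
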